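(* For all integers $m\ge 3$ and $n\ge 1$, the spiral $\mathcal S_m^n$ is upper embeddable, i.e. $\gamma_M(\mathcal S_m^n)=\lfloor (n+1)/2\rfloor$. Furthermore, $\gamma_M(\mathcal S_m^n-v_{m+2n-2})=\gamma_M(\mathcal S_m^n)-1$, i.e. $v_{m+2n-2}$ is a 1-critical-vertex of $\mathcal S_m^n$.
   Context: Spiral $\mathcal S_m^n$ ($m\ge3$, $n\ge1$): the graph on vertices $v_1,\dots,v_{m+2n}$ which is the union of $p_0,p_1,\dots,p_n$, where $p_0$ is the $m$-cycle $v_1v_2\cdots v_mv_1$; for $1\le i\le m-1$, $p_i$ is the path $v_{m+2i-2}v_{m+2i-1}v_{m+2i}v_i$ (3 edges, with new internal vertices $v_{m+2i-1},v_{m+2i}$); and for $i>m-1$, $p_i$ is the path $v_{m+2i-2}v_{m+2i-1}v_{m+2i}v_{2i-m+1}$ (with new internal vertices $v_{m+2i-1},v_{m+2i}$). Its Betti number is $\beta=|E|-|V|+1=n+1$. $\gamma_M(H)$ is the maximum genus of a connected graph $H$ (largest $k$ such that $H$ embeds cellularly in the orientable surface of genus $k$); $H$ is upper embeddable if $\gamma_M(H)=\lfloor\beta(H)/2\rfloor$. A vertex $v$ is a 1-critical-vertex of $G$ if $G-v$ is connected and $\gamma_M(G-v)=\gamma_M(G)-1$. *)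

(* Defs.v *)
From mathcomp Require Import all_boot all_fingroup.
Set Implicit Arguments. Unset Strict Implicit. Unset Printing Implicit Defensive.

(* Simple graphs: a symmetric irreflexive relation e on a finite vertex type V.
   Darts (arcs) are ordered pairs (u,w) with e u w. *)
Section Graphs.
Variables (V : finType) (e : rel V).

Definition is_dart (d : V * V) : bool := e d.1 d.2.

Definition nedges : nat := #|[set d : V * V | is_dart d]| %/ 2.

Definition connectedb : bool := [forall x, forall y, connect e x y].

(* A rotation system (combinatorial orientable embedding, Heffter-Edmonds):
   a permutation p of V*V fixing non-darts, mapping each dart (u,w) to a dart
   (u,w') at the same vertex u, and cyclically permuting all darts at u
   in a single cycle. *)
Definition is_rotation (p : {perm V * V}) : bool :=
  [forall d : V * V,
    if is_dart d then
      [&& (p d).1 == d.1, is_dart (p d) &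
          [forall d' : V * V, ((d'.1 == d.1) && is_dart d') ==> (d' \in porbit p d)]]
    else p d == d].

Definition dart_rev (d : V * V) : V * V := (d.2, d.1).
Lemma dart_revK : involutive dart_rev. Proof. by case. Qed.
Definition rev_perm : {perm V * V} := perm (inv_inj dart_revK).

Definition face_perm (p : {perm V * V}) : {perm V * V} := (rev_perm * p)%g.

Definition nfaces (p : {perm V * V}) : nat :=
  #|[set porbit (face_perm p) d | d in [set d : V * V | is_dart d]]|.

(* genus of the orientable cellular embedding given by p (Euler's formula
   |V| - |E| + |F| = 2 - 2g, for a connected graph) *)
Definition emb_genus (p : {perm V * V}) : nat :=
  (nedges + 2 - #|V| - nfaces p) %/ 2.

Definition max_genus : nat :=
  \max_(p : {perm V * V} | is_rotation p) emb_genus p.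

Definition betti : nat := nedges + 1 - #|V|.

Definition upper_embeddable : Prop := max_genus = (betti)./2.
End Graphs.

Definition del_vertex (V : finType) (e : rel V) (v : V) : rel {x : V | x != v} :=
  fun x y => e (val x) (val y).

(* Spiral S_m^n, on 1-based vertex labels a, b (v_a, v_b). *)
Definition spiral_base (m n a b : nat) : bool :=
  [|| (1 <= a < m) && (b == a.+1),
      (a == m) && (b == 1) |
      [exists i : 'I_n.+1, (0 < i) &&
        (let s := m + 2 * i - 2 in
         let t := if i <= m - 1 then val i else 2 * i - m + 1 in
         [|| (a == s) && (b == s.+1),
             (a == s.+1) && (b == s.+2) |
             (a == s.+2) && (b == t)])]].

Definition spiral_adj (m n a b : nat) : bool :=
  spiral_base m n a b || spiral_base m n b a.

(* the spiral on vertex set 'I_(m+2n), where ordinal k stands for v_(k+1) *)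
Definition spiral (m n : nat) : rel 'I_(m + 2 * n) :=
  fun x y => spiral_adj m n (val x).+1 (val y).+1.
Arguments spiral : clear implicits.
Arguments del_vertex {V} e v.

(* Main.v *)
(* A rotation system is enlarged dart by dart: inserting a dart d after a dart a
   multiplies the rotation by a transposition, hence also the face permutation, and
   counting cycles shows that a pendant edge keeps the number of faces, an edge
   with both ends on the same face adds one, and an edge joining two faces removes
   one.  Consequently two edges with a common end can always be added to a
   one-face embedding so as to keep it one-face.  Going from S_m^n to S_m^(n+2)
   amounts to adding pendant edges and such a pair of edges at v_(m+2n+2), so
   S_m^n has a one-face embedding for odd n and a two-face embedding for even n,
   which meets the bound betti/2 given by Euler's formula.  Deleting v_(m+2n-2)
   leaves S_m^(n-2) with pendant edges attached (a tree if n = 1). *)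
Require Import Defs.
From mathcomp Require Import all_boot all_fingroup.
From mathcomp Require Import zify.
Set Implicit Arguments. Unset Strict Implicit. Unset Printing Implicit Defensive.

(** * Cycles of permutations *)

Section Perms.
Variable T : finType.
Implicit Types (s : {perm T}) (x y z a d : T).

Lemma porbit_closed s (S : {set T}) x :
  {in S, forall y, s y \in S} -> x \in S -> porbit s x \subset S.
Proof.
move=> sS Sx; apply/subsetP => _ /porbitP[i ->].
by elim: i => [|i IH]; rewrite ?perm1 // expgSr permM sS.
Qed.

Lemma porbit_step s x y : x \in porbit s y -> s x \in porbit s y.
Proof. by case/porbitP=> i ->; rewrite -permM -expgSr mem_porbit. Qed.

Lemma porbit_trans s x y z :
  x \in porbit s y -> y \in porbit s z -> x \in porbit s z.
Proof. by rewrite -!eq_porbit_mem => /eqP->. Qed.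

(** The product sends [a] to [d] and [d] to [s a]: it splices the fixed point [d] into the cycle of
    [a], so no orbit loses a point. *)
Lemma porbit_insert s a d x y : s d = d -> a != d ->
  x \in porbit s y -> x \in porbit (tperm a d * s)%g y.
Proof.
move=> sd nad; set s' := (_ * s)%g; move: x; apply/subsetP/porbit_closed; last exact: porbit_id.
move=> x xs'; apply: porbit_trans xs'.
have s'a : s' a = d by rewrite permM tpermL.
have s'd : s' d = s a by rewrite permM tpermR.
have [->|nxa] := eqVneq x a; first by rewrite -s'd -s'a !porbit_step ?porbit_id.
have [->|nxd] := eqVneq x d; first by rewrite sd porbit_id.
suff -> : s x = s' x by rewrite porbit_step ?porbit_id.
by rewrite permM tpermD // eq_sym.
Qed.

(** Multiplying twice by the transposition gives back [s]. The first product gains a cycle, so the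
    second must lose it again, which happens only if [a] and [d] were separated. *)
Lemma tperm_split s a d : a != d -> a \in porbit s d ->
  d \notin porbit (tperm a d * s)%g a.
Proof.
move=> nad aSd; have := porbits_mul_tperm s a d.
have := porbits_mul_tperm (tperm a d * s)%g a d.
rewrite /= mulgA tperm2 mul1g aSd nad /= [d \in _]porbit_sym.
by case: (a \in _) => //=; lia.
Qed.

(** * Absorbing a two-cycle into other cycles *)

Section TwoCycle.
Variables (s : {perm T}) (d d' b : T).
Hypotheses (sd : s d = d') (sd' : s d' = d) (ndd' : d != d') (nbd : b != d) (nbd' : b != d').

Lemma porbit_two_cycle x : x \in porbit s d -> x = d \/ x = d'.
Proof.
suff /subsetP H : porbit s d \subset [set d; d'] by move/H/set2P.
by apply: porbit_closed; last exact: set21; move=> y /set2P[]->; rewrite ?sd ?sd' !inE eqxx ?orbT.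
Qed.

Lemma two_cycle_notin x : x != d -> x != d' -> x \notin porbit s d.
Proof. by move=> xd xd'; apply/negP => /porbit_two_cycle[]/eqP; exact/negP. Qed.

Lemma porbits_merge : #|porbits (tperm b d * s)%g|.+1 = #|porbits s|.
Proof. by have := porbits_mul_tperm s b d; rewrite /= two_cycle_notin // nbd; lia. Qed.

(** The new cycle runs [b], [d'], [d], [s b] and then on as before: it is the old cycle of [b] with
    the two-cycle spliced in. *)
Lemma porbit_merge x : x != d -> x != d' ->
  (x \in porbit (tperm b d * s)%g d') = (x \in porbit s b).
Proof.
move=> xd xd'; set s1 := (_ * s)%g.
have s1b : s1 b = d' by rewrite permM tpermL.
have s1d : s1 d = s b by rewrite permM tpermR.
have s1d' : s1 d' = d by rewrite permM tpermD.
have s1D y : y != b -> y != d -> s1 y = s y by move=> *; rewrite permM tpermD // eq_sym.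
have -> : porbit s1 d' = porbit s1 b by apply/eqP; rewrite eq_porbit_mem -s1b porbit_step ?porbit_id.
apply/idP/idP.
  have /subsetP H : porbit s1 b \subset [set d; d'] :|: porbit s b.
    apply: porbit_closed; last by rewrite !inE porbit_id !orbT.
    move=> y; have [->|yb] := eqVneq y b; first by rewrite s1b !inE eqxx ?orbT.
    have [->|yd] := eqVneq y d; first by rewrite s1d !inE porbit_step ?porbit_id ?orbT.
    have [->|yd'] := eqVneq y d'; first by rewrite s1d' !inE !eqxx ?orbT.
    by rewrite s1D // !inE (negPf yd) (negPf yd') /= => /porbit_step->; rewrite orbT.
  by move/H; rewrite !inE (negPf xd) (negPf xd').
(* Conversely, one step of [s] from [b] amounts to three steps of [s1], through [d'] and [d];
   elsewhere on the cycle the two agree. *)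
suff /subsetP H : porbit s b \subset porbit s1 b :\: [set d; d'] by move/H; rewrite !inE => /andP[].
apply: porbit_closed; last by rewrite !inE porbit_id (negPf nbd) (negPf nbd').
move=> y; rewrite !inE negb_or => /andP[/andP[yd yd'] ys].
have -> : (s y == d) = false by rewrite -sd' (inj_eq perm_inj) (negPf yd').
have -> : (s y == d') = false by rewrite -sd (inj_eq perm_inj) (negPf yd).
have [->|yb] /= := eqVneq y b; last by rewrite -s1D ?porbit_step.
by rewrite -s1d -s1d' -s1b !porbit_step ?porbit_id.
Qed.

(** The inner transposition loses one cycle. The outer one regains it by a split when [a] is on the
    cycle of [b], and loses another by a merge otherwise. *)
Lemma porbits_insert2 a : a != d -> a != d' ->
  #|porbits (tperm a d' * (tperm b d * s))%g| + (a \notin porbit s b).*2 = #|porbits s|.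
Proof.
move=> ad ad'; have := porbits_mul_tperm (tperm b d * s)%g a d'.
by rewrite /= porbit_merge // ad' -porbits_merge => ->; rewrite addn1.
Qed.

End TwoCycle.

End Perms.

(** * Rotation systems and edge additions *)

Section Rotations.
Variable V : finType.
Implicit Types (e : rel V) (p : {perm V * V}) (d a b : V * V).

Definition graph_rel e := symmetric e /\ irreflexive e.

(** One direction only: [is_rotation] does not ask for symmetry, so rotations can be enlarged one
    dart at a time. *)
Definition add_dart e d : rel V := fun x y => e x y || ((x, y) == d).

Definition add_edge e d : rel V := add_dart (add_dart e (dart_rev d)) d.

Lemma is_rotationP e p :
  reflect [/\ forall d, is_dart e d -> [/\ (p d).1 = d.1, is_dart e (p d) &
              forall d', d'.1 = d.1 -> is_dart e d' -> d' \in porbit p d]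
            & forall d, ~~ is_dart e d -> p d = d] (is_rotation e p).
Proof.
apply: (iffP forallP) => [H|[H1 H2] d].
  split=> d Hd; have := H d; last by rewrite (negPf Hd) => /eqP.
  rewrite Hd => /and3P[/eqP ? ? /forallP h]; split=> // d' e1 e2.
  by have := h d'; rewrite e1 eqxx e2.
case: ifP => Hd; last by rewrite H2 ?Hd.
have [-> -> h] := H1 d Hd; rewrite eqxx /=; apply/forallP=> d'; apply/implyP.
by case/andP=> /eqP; apply: h.
Qed.

Lemma eq_is_rotation e e' p : e =2 e' -> is_rotation e p = is_rotation e' p.
Proof.
move=> E; apply: eq_forallb => d; rewrite /is_dart !E.
by case: ifP => // _; congr [&& _, _ & _]; apply: eq_forallb => d'; rewrite E.
Qed.

Lemma is_dart_add e d d' : is_dart (add_dart e d) d' = is_dart e d' || (d' == d).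
Proof. by rewrite /is_dart /add_dart -surjective_pairing. Qed.

(** The transposition places [d] right after [a] in the cyclic order at their common vertex. *)
Lemma rotation_insert e p a d : is_rotation e p -> is_dart e a -> a.1 = d.1 ->
  ~~ is_dart e d -> is_rotation (add_dart e d) (tperm a d * p)%g.
Proof.
move=> /is_rotationP[rp np] ea ad ed; apply/is_rotationP.
have nad : a != d by apply: contraNneq ed => <-.
have pd := np d ed; set p' := (_ * p)%g.
have p'a : p' a = d by rewrite permM tpermL.
have p'd : p' d = p a by rewrite permM tpermR.
have p'D x : x != a -> x != d -> p' x = p x.
  by move=> xa xd; rewrite permM tpermD // eq_sym.
have [pa1 pa2 pa3] := rp a ea.
split=> [x|x]; rewrite is_dart_add; last first.
  rewrite negb_or => /andP[ex xd]; rewrite p'D ?np //.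
  by apply: contraNneq ex => ->.
move=> ex; split.
- have [->|xa] := eqVneq x a; first by rewrite p'a.
  have [->|xd] := eqVneq x d; first by rewrite p'd pa1.
  by rewrite p'D //; case: (rp x) => //; move: ex; rewrite (negPf xd) orbF.
- rewrite is_dart_add; have [->|xa] := eqVneq x a; first by rewrite p'a eqxx orbT.
  have [->|xd] := eqVneq x d; first by rewrite p'd pa2.
  by rewrite p'D //; case: (rp x) => [|_ ->] //; move: ex; rewrite (negPf xd) orbF.
have da : d \in porbit p' a by rewrite -p'a porbit_step ?porbit_id.
have key y z : is_dart e y -> z.1 = y.1 -> is_dart e z -> z \in porbit p' y.
  by move=> ey zy ez; apply: porbit_insert => //; case: (rp y ey) => _ _; apply.
move=> z zx; rewrite is_dart_add.
have [zd _|zd] := eqVneq z d; have [xd|xd] := eqVneq x d.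
- by rewrite zd xd porbit_id.
- rewrite zd; apply: porbit_trans da _; apply: key => //.
  + by move: ex; rewrite (negPf xd) orbF.
  + by rewrite ad -zd.
- rewrite orbF => ez; rewrite xd.
  apply: (@porbit_trans _ _ _ a); last by rewrite porbit_sym.
  by apply: key => //; rewrite zx xd.
- by rewrite orbF; apply: key => //; move: ex; rewrite (negPf xd) orbF.
Qed.

(** As a non-dart, [d] is already fixed by [p], and a fixed point is the right cyclic order at a
    vertex with a single dart. *)
Lemma rotation_new e p d : is_rotation e p ->
  (forall a, a.1 = d.1 -> ~~ is_dart e a) -> is_rotation (add_dart e d) p.
Proof.
move=> /is_rotationP[rp np] nd; apply/is_rotationP; have pd : p d = d by rewrite np ?nd.
split=> x; rewrite is_dart_add; last by rewrite negb_or => /andP[/np].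
have [->|xd] := eqVneq x d; last first.
  rewrite orbF => ex; have [h1 h2 h3] := rp x ex.
  rewrite is_dart_add h2; split=> // y yx; rewrite is_dart_add.
  case/orP => [|/eqP yd]; first exact: h3.
  by have := nd x; rewrite -yx yd ex => /(_ erefl).
rewrite pd is_dart_add eqxx orbT => _; split=> // y yd; rewrite is_dart_add.
by rewrite (negPf (nd _ yd)) => /eqP->; rewrite porbit_id.
Qed.

Lemma rev_permE d : rev_perm V d = dart_rev d.
Proof. by rewrite permE. Qed.

Lemma dart_rev_inj : injective (@dart_rev V).
Proof. exact: inv_inj (@dart_revK V). Qed.

Lemma face_permE p d : face_perm p d = p (dart_rev d).
Proof. by rewrite permM rev_permE. Qed.

(** Moving the transposition past the reversal conjugates it, so the face permutation also changes
    by a transposition and the cycle counts apply. *)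
Lemma face_perm_insert p a d :
  face_perm (tperm a d * p) = (tperm (dart_rev a) (dart_rev d) * face_perm p)%g.
Proof.
apply/permP => x; rewrite !(permM, rev_permE); congr (p _).
by rewrite (inj_tperm _ _ _ dart_rev_inj) !dart_revK.
Qed.

Lemma is_dart_rev e d : graph_rel e -> is_dart e (dart_rev d) = is_dart e d.
Proof. by case=> sy _; rewrite /is_dart sy. Qed.

Lemma porbit_nondart e p d : graph_rel e -> is_rotation e p -> ~~ is_dart e d ->
  porbit (face_perm p) d = [set d; dart_rev d].
Proof.
move=> ge /is_rotationP[_ np] ed; have ed' : ~~ is_dart e (dart_rev d) by rewrite is_dart_rev.
have fd : face_perm p d = dart_rev d by rewrite face_permE np.
have fd' : face_perm p (dart_rev d) = d by rewrite face_permE dart_revK np.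
apply/eqP; rewrite eqEsubset subUset !sub1set porbit_id; apply/andP; split.
  apply: porbit_closed; last exact: set21.
  by move=> y /set2P[]->; rewrite ?fd ?fd' !inE eqxx ?orbT.
by rewrite -[X in X \in _]fd porbit_step ?porbit_id.
Qed.

(** Diagonal pairs [(x, x)] are non-darts and count as singletons. *)
Definition nnonedges e := #|[set [set d; dart_rev d] | d in [set d | ~~ is_dart e d]]|.

(* A non-dart is fixed by a rotation, so it forms with its reversal an orbit of
   the face permutation that lies outside the embedding. *)
Lemma porbits_face e p : graph_rel e -> is_rotation e p ->
  #|porbits (face_perm p)| = nfaces e p + nnonedges e.
Proof.
move=> ge rp; set f := face_perm p.
pose A := [set porbit f d | d in [set d | is_dart e d]].
pose B := [set porbit f d | d in [set d | ~~ is_dart e d]].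
have -> : nnonedges e = #|B|.
  apply: eq_card => S; apply/imsetP/imsetP => -[d]; rewrite inE => ed ->; exists d;
    by rewrite ?inE // (porbit_nondart ge rp).
have -> : porbits f = A :|: B.
  apply/setP => S; apply/imsetP/setUP => [[d _ ->]|[]/imsetP[d _ ->]]; try by exists d.
  by have [ed|ed] := boolP (is_dart e d); [left | right]; apply/imsetP; exists d; rewrite ?inE.
rewrite cardsU (_ : A :&: B = set0) ?cards0 ?subn0 //.
apply/setP => S; rewrite inE in_set0; apply/andP => -[/imsetP[d + ->] /imsetP[d' + /eqP]].
rewrite !inE eq_porbit_mem => ed ed'; rewrite (porbit_nondart ge rp ed') !inE.
by case/orP=> /eqP E; rewrite E ?is_dart_rev // in ed; rewrite ed in ed'.
Qed.

Lemma is_dart_add_edge e d x :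
  is_dart (add_edge e d) x = [|| is_dart e x, x == dart_rev d | x == d].
Proof. by rewrite /add_edge !is_dart_add orbA. Qed.

Lemma add_edge_graph e d : graph_rel e -> dart_rev d != d -> graph_rel (add_edge e d).
Proof.
move=> [sy ir] nd; split=> [x y|x]; rewrite -!/(is_dart (add_edge e d) (_, _)) !is_dart_add_edge.
  rewrite /is_dart /= sy; congr (_ || _).
  by rewrite orbC -(inj_eq dart_rev_inj (x, y) d) -(inj_eq dart_rev_inj (x, y)) dart_revK.
rewrite /is_dart /= ir /=; case: d nd => u w; rewrite /dart_rev /= => nd.
by apply/norP; split; apply: contraNneq nd => -[-> ->].
Qed.

Lemma nnonedges_add e d : graph_rel e -> ~~ is_dart e d ->
  nnonedges e = (nnonedges (add_edge e d)).+1.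
Proof.
move=> ge ed; rewrite /nnonedges; set B := [set _ | _ in [set _ | ~~ is_dart (add_edge _ _) _]].
have -> : [set [set x; dart_rev x] | x in [set x | ~~ is_dart e x]]
    = [set d; dart_rev d] |: B.
  apply/setP => S; rewrite inE in_set1; apply/imsetP/orP => [[x + ->]|[/eqP->|/imsetP[x + ->]]].
  - rewrite inE => ex; have [->|xd] := eqVneq x d; first by left.
    have [->|xd'] := eqVneq x (dart_rev d); first by left; rewrite dart_revK setUC.
    right; apply/imsetP; exists x => //; rewrite inE is_dart_add_edge.
    by rewrite (negPf ex) (negPf xd) (negPf xd').
  - by exists d; rewrite ?inE.
  - by rewrite inE is_dart_add_edge negb_or => /andP[ex _]; exists x; rewrite ?inE.
rewrite cardsU1; case: imsetP => // -[x]; rewrite inE is_dart_add_edge => ex E.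
have := set21 d (dart_rev d); rewrite E => /set2P[] E'; rewrite E' ?dart_revK eqxx ?orbT // in ex.
Qed.

Lemma card_darts_add e d : graph_rel e -> ~~ is_dart e d -> dart_rev d != d ->
  #|[set x | is_dart (add_edge e d) x]| = #|[set x | is_dart e x]| + 2.
Proof.
move=> ge ed nd.
have -> : [set x | is_dart (add_edge e d) x] = d |: (dart_rev d |: [set x | is_dart e x]).
  apply/setP => x; rewrite !inE is_dart_add_edge.
  by case: (is_dart e x) (x == d) (x == dart_rev d) => [] [] [].
by rewrite !cardsU1 !inE is_dart_rev // (negPf ed) eq_sym (negPf nd); lia.
Qed.

(** Each end carries one dart, so the identity is a rotation; the face permutation is then the
    reversal, and both sides of the edge form its only face. *)
Lemma nfaces_single e d : (forall x, ~~ is_dart e x) -> dart_rev d != d ->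
  is_rotation (add_edge e d) 1%g /\ nfaces (add_edge e d) 1%g = 1.
Proof.
move=> e0 nd; split.
  apply/is_rotationP; split=> x; rewrite perm1 // is_dart_add_edge (negPf (e0 x)) /= => ex.
  split=> // y yx.
  rewrite is_dart_add_edge (negPf (e0 y)) /= => ey.
  suff -> : y = x by rewrite porbit_id.
  have nd1 : d.1 != d.2 by apply: contraNneq nd; case: (d) => u w /= ->.
  case/orP: ex yx => /eqP->; case/orP: ey => /eqP-> //= /eqP; first by rewrite (negPf nd1).
  by rewrite eq_sym (negPf nd1).
rewrite /nfaces -(cards1 (porbit (face_perm (1%g : {perm V * V})) d)).
apply: eq_card => S; rewrite inE; apply/imsetP/eqP => [[x + ->]|->]; last first.
  by exists d; rewrite // inE is_dart_add_edge eqxx !orbT.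
rewrite inE is_dart_add_edge (negPf (e0 x)) => /= /orP[]/eqP-> //; apply/eqP.
have -> : dart_rev d = face_perm 1 d by rewrite face_permE perm1.
by rewrite eq_porbit_mem porbit_step ?porbit_id.
Qed.

(** * Effect of one new edge on the faces *)

Section AddEdge.
Variables (e : rel V) (p : {perm V * V}) (d a : V * V).
Hypotheses (ge : graph_rel e) (rp : is_rotation e p) (ed : ~~ is_dart e d)
  (nd : dart_rev d != d) (ea : is_dart e a) (ad : a.1 = d.1).

Let f := face_perm p.
Let e' := add_edge e d.

(** A missing edge is a two-cycle of the face permutation, to which the two-cycle lemmas apply. *)
Let fd : f d = dart_rev d.
Proof. by case/is_rotationP: rp => _ np; rewrite /f face_permE np // is_dart_rev. Qed.

Let fdr : f (dart_rev d) = d.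
Proof. by case/is_rotationP: rp => _ np; rewrite /f face_permE dart_revK np. Qed.

Let rev_dart_neq x : is_dart e x -> dart_rev x != d /\ dart_rev x != dart_rev d.
Proof.
move=> ex; rewrite (inj_eq dart_rev_inj); split; apply: contraNneq ed => <- //.
by rewrite is_dart_rev.
Qed.

(** The reverse dart is alone at its vertex, so a single transposition is made. It merges a
    two-cycle into a face, and the cycle lost is the missing edge just used up. *)
Lemma add_pendant : (forall x, x.1 = d.2 -> ~~ is_dart e x) ->
  is_rotation e' (tperm a d * p)%g /\ nfaces e' (tperm a d * p)%g = nfaces e p.
Proof.
move=> e2; have rp' : is_rotation e' (tperm a d * p)%g.
  apply: rotation_insert => //; first exact: rotation_new.
    by rewrite is_dart_add ea.
  by rewrite is_dart_add negb_or ed eq_sym.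
split=> //; have [n1 n2] := rev_dart_neq ea.
have := porbits_face (add_edge_graph ge nd) rp'; rewrite face_perm_insert -/f.
have := porbits_merge fdr fd nd n2 n1; have := porbits_face ge rp.
by rewrite (nnonedges_add ge ed) -/f -/e' => -> h1 h2; rewrite h2 addnS in h1; case: h1 => /addIn ->.
Qed.

Variables (b : V * V).
Hypotheses (eb : is_dart e b) (bd : b.1 = d.2).

Let p' := (tperm a d * (tperm b (dart_rev d) * p))%g.

Lemma add_edge_rotation : is_rotation e' p'.
Proof.
apply: rotation_insert => //; last by rewrite is_dart_add negb_or ed eq_sym.
  by apply: rotation_insert; rewrite // is_dart_rev.
by rewrite is_dart_add ea.
Qed.

Let f'E : face_perm p' = (tperm (dart_rev a) (dart_rev d) * (tperm (dart_rev b) d * f))%g.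
Proof. by rewrite !face_perm_insert dart_revK. Qed.

(** Since [f] sends [dart_rev a] to [p a], it stands for the corner after [a], where [d] is drawn;
    likewise [dart_rev b] at the other end. Corners on a common face give one face more, corners on
    different faces one less. *)
Lemma add_edge_nfaces :
  nfaces e' p' + (dart_rev a \notin porbit f (dart_rev b)).*2 = (nfaces e p).+1.
Proof.
have [a1 a2] := rev_dart_neq ea; have [b1 b2] := rev_dart_neq eb.
have := porbits_face (add_edge_graph ge nd) add_edge_rotation; rewrite f'E.
have nd' : d != dart_rev d by rewrite eq_sym.
have := porbits_insert2 fd fdr nd' b1 b2 a1 a2; have := porbits_face ge rp.
rewrite (nnonedges_add ge ed) -/f -/e' => -> h1 h2.
by apply/eqP; rewrite -(eqn_add2r (nnonedges e')) addnAC -h2 h1 addnS addSn.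
Qed.

(** When the edge splits a face, the corners on the two sides of [d] at its first end fall into
    different faces. *)
Lemma add_edge_corners : dart_rev a \in porbit f (dart_rev b) ->
  dart_rev d \notin porbit (face_perm p') (dart_rev a).
Proof.
have [a1 a2] := rev_dart_neq ea; have [b1 b2] := rev_dart_neq eb => ab.
by rewrite f'E; apply: tperm_split => //; rewrite porbit_merge // eq_sym.
Qed.

End AddEdge.

Lemma nfaces1_porbit e p a b : nfaces e p = 1 -> is_dart e a -> is_dart e b ->
  a \in porbit (face_perm p) b.
Proof.
move=> /eqP/cards1P[S HS] ea eb.
have H x : is_dart e x -> porbit (face_perm p) x = S.
  by move=> ex; apply/set1P; rewrite -HS imset_f // inE.
by rewrite (H _ eb) -(H _ ea) porbit_id.
Qed.

(* Two edges added at a common vertex to a one-face embedding: the first one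
   splits the face and lies on both sides, so its two corners at the common vertex
   are in different faces, and the second edge can start in the one its other end
   is not on. *)
Lemma add_cherry e p d d' a b c : graph_rel e -> is_rotation e p -> nfaces e p = 1 ->
  d'.1 = d.1 -> d' != d -> dart_rev d' != d' -> dart_rev d != d ->
  ~~ is_dart e d -> ~~ is_dart e d' ->
  is_dart e a -> a.1 = d.1 -> is_dart e b -> b.1 = d.2 -> is_dart e c -> c.1 = d'.2 ->
  exists2 p', is_rotation (add_edge (add_edge e d) d') p'
            & nfaces (add_edge (add_edge e d) d') p' = 1.
Proof.
move=> ge rp F1 d1 ndd nd' nd ed ed' ea ad eb bd ec cd.
set e1 := add_edge e d; have g1 : graph_rel e1 by exact: add_edge_graph.
set p1 := (tperm a d * (tperm b (dart_rev d) * p))%g.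
have rp1 : is_rotation e1 p1 by exact: add_edge_rotation.
have ab : dart_rev a \in porbit (face_perm p) (dart_rev b).
  by apply: nfaces1_porbit F1 _ _; rewrite is_dart_rev.
have F2 : nfaces e1 p1 = 2.
  by have := add_edge_nfaces ge rp ed nd ea ad eb bd; rewrite ab F1 addn0.
have nda := add_edge_corners ge rp ed nd ea eb ab; rewrite -/p1 in nda.
have sub x : is_dart e x -> is_dart e1 x by rewrite is_dart_add_edge => ->.
(* The two darts start at the same vertex, so [d'] could be the reverse of [d] only if [d] were a
   loop. *)
have ed1 : ~~ is_dart e1 d'.
  rewrite is_dart_add_edge (negPf ed') (negPf ndd) orbF; apply: contra nd => /eqP dd.
  move: d1; rewrite dd /=; case: (d) => u w /= ->; exact: eqxx.
(* The candidates are the corners after [a] and after [d]; the corner after [c] shares a face with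
   at most one of them. *)
have [a' [ea' ad' nac]] : exists a', [/\ is_dart e1 a', a'.1 = d'.1 &
    dart_rev a' \notin porbit (face_perm p1) (dart_rev c)].
  have [ac|ac] := boolP (dart_rev a \in porbit (face_perm p1) (dart_rev c)); last first.
    by exists a; rewrite sub // d1.
  exists d; rewrite is_dart_add_edge eqxx !orbT d1; split=> //.
  by apply: contra nda => dc; apply: porbit_trans dc _; rewrite porbit_sym.
have ec1 := sub c ec.
exists (tperm a' d' * (tperm c (dart_rev d') * p1))%g; first exact: add_edge_rotation.
have := add_edge_nfaces g1 rp1 ed1 nd' ea' ad' ec1 cd.
by rewrite F2 nac addn2 => -[].
Qed.

End Rotations.

(** * The genus bound from Euler's formula *)

Section Ext.
Variable V : finType.
Implicit Types (e : rel V) (p : {perm V * V}).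

Lemma eq_nfaces e e' p : e =2 e' -> nfaces e p = nfaces e' p.
Proof.
move=> E; rewrite /nfaces; congr #|[set _ | _ in pred_of_set _]|.
by apply/setP => d; rewrite !inE /is_dart E.
Qed.

Lemma eq_nedges e e' : e =2 e' -> nedges e = nedges e'.
Proof.
by move=> E; rewrite /nedges; congr (_ %/ _); apply: eq_card => d; rewrite !inE /is_dart E.
Qed.

Lemma eq_add_edge e e' d : e =2 e' -> add_edge e d =2 add_edge e' d.
Proof. by move=> E x y; rewrite /add_edge /add_dart E. Qed.

(** An edge forces at least one face, and Euler's formula does the rest. *)
Lemma emb_genus_le e p : 0 < nedges e -> emb_genus e p <= (betti e)./2.
Proof.
move=> e0; have : 0 < nfaces e p.
  rewrite card_gt0; have /card_gt0P[d] : 0 < #|[set d | is_dart e d]|.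
    by apply: leq_trans e0 (leq_div _ _).
  by move=> ed; apply/set0Pn; exists (porbit (face_perm p) d); apply: imset_f.
by rewrite /emb_genus /betti; lia.
Qed.

(** By parity one or two faces is the least possible number, so [p] attains the bound; the
    inequality on [#|V|] makes the truncated subtractions exact. *)
Lemma max_genus_eq e p : 0 < nedges e -> is_rotation e p ->
  nfaces e p = 1 + odd (betti e) -> #|V| <= nedges e + 1 -> max_genus e = (betti e)./2.
Proof.
move=> e0 rp Fp cV; apply/eqP; rewrite eqn_leq; apply/andP; split.
  by apply/bigmax_leqP => q _; apply: emb_genus_le.
apply: leq_trans (leq_bigmax_cond _ rp).
by move: Fp; rewrite /emb_genus /betti => ->; lia.
Qed.

End Ext.

(** * Labelled edge lists *)

Definition adj (s : seq (nat * nat)) a b := ((a, b) \in s) || ((b, a) \in s).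

Definition verts (s : seq (nat * nat)) := unzip1 s ++ unzip2 s.

Lemma adj_cons a b s x y :
  adj ((a, b) :: s) x y = [|| (x == a) && (y == b), (y == a) && (x == b) | adj s x y].
Proof.
by rewrite /adj !inE !xpair_eqE; case: (_ && _); case: (_ && _); rewrite //= ?orbT.
Qed.

Lemma adj_sym s x y : adj s x y = adj s y x.
Proof. exact: orbC. Qed.

Lemma adj_flip s a b x y : adj ((a, b) :: s) x y = adj ((b, a) :: s) x y.
Proof. by rewrite !adj_cons andbC orbCA [(y == a) && _]andbC. Qed.

Lemma verts_cons a b s x : x \in verts ((a, b) :: s) = [|| x == a, x == b | x \in verts s].
Proof.
by rewrite /verts mem_cat /= !inE mem_cat -!orbA; congr (_ || _); rewrite orbCA.
Qed.

Lemma vertsP s a : reflect (exists b, adj s a b) (a \in verts s).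
Proof.
rewrite mem_cat; apply: (iffP orP) => [[]/mapP[[x y] xs /= ->]|[b /orP[]xs]].
- by exists y; rewrite /adj xs.
- by exists x; rewrite /adj xs orbT.
- by left; apply/mapP; exists (a, b).
- by right; apply/mapP; exists (b, a).
Qed.

Lemma adj_verts s a b : adj s a b -> (a \in verts s) && (b \in verts s).
Proof. by move=> h; apply/andP; split; apply/vertsP; [exists b | exists a; rewrite adj_sym]. Qed.

(** * Embeddings of graphs given by labelled edge lists *)

Section Labelled.
Variables (V : finType) (L : V -> nat).
Hypothesis injL : injective L.
Implicit Types (s : seq (nat * nat)) (F : nat) (u w x y : V).

(* Labels in [codom L] that do not occur in [s] give isolated vertices: all stages of a
   construction by edge additions live on the same vertex type. *)
Definition gr s : rel V := fun x y => adj s (L x) (L y).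

(** The dart count in [emb_edges] says that no edge is listed twice, in either direction.
    Connectivity concerns only the vertices that occur, the others being isolated. *)
Record emb s F : Prop := Emb {
  emb_verts : {subset verts s <= codom L};
  emb_loopless : forall a, ~~ adj s a a;
  emb_edges : #|[set d | is_dart (gr s) d]| = (size s).*2;
  emb_conn : forall x y, L x \in verts s -> L y \in verts s -> connect (gr s) x y;
  emb_rot : exists2 p, is_rotation (gr s) p & nfaces (gr s) p = F }.

Lemma emb_sim s s' F : adj s =2 adj s' -> size s = size s' -> emb s F -> emb s' F.
Proof.
move=> E sz [h1 h2 h3 h4 [p rp Fp]].
have Eg : gr s =2 gr s' by move=> x y; apply: E.
have Ev : verts s =i verts s'.
  by move=> a; apply/vertsP/vertsP => -[b h]; exists b; rewrite ?E // -E.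
split=> [a|a|| x y|].
- by rewrite -Ev; apply: h1.
- by rewrite -E.
- by rewrite -sz -h3; apply: eq_card => d; rewrite !inE /is_dart Eg.
- by rewrite -!Ev -(eq_connect Eg); apply: h4.
- by exists p; rewrite -?(eq_is_rotation _ Eg) // -(eq_nfaces _ Eg).
Qed.

Lemma emb_perm s s' F : perm_eq s s' -> emb s F -> emb s' F.
Proof.
move=> E; apply: emb_sim; last exact: perm_size.
by move=> a b; rewrite /adj !(perm_mem E).
Qed.

Lemma emb_flip s a b F : emb ((a, b) :: s) F -> emb ((b, a) :: s) F.
Proof.
by apply: emb_sim => // x y; apply: adj_flip.
Qed.

Lemma gr_graph s F : emb s F -> graph_rel (gr s).
Proof. by case=> _ h _ _ _; split=> [x y|x]; [apply: adj_sym | exact: negbTE (h (L x))]. Qed.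

Lemma gr_cons s u w : gr ((L u, L w) :: s) =2 add_edge (gr s) (u, w).
Proof.
move=> x y; rewrite /gr adj_cons !(inj_eq injL) /add_edge /add_dart /dart_rev !xpair_eqE /=.
by rewrite -/(gr s x y) [(y == u) && _]andbC; case: (gr s x y) (_ && _) (_ && _) => [] [] [].
Qed.

(** Faces are orbits of darts, so the empty graph has none, not one. *)
Lemma emb_nil : emb [::] 0.
Proof.
split=> //; first by apply: eq_card0 => d; rewrite inE.
exists 1%g; first by apply/is_rotationP; split=> d; rewrite // perm1.
by apply: eq_card0 => S; apply/imsetP => -[d]; rewrite inE.
Qed.

Lemma emb_extend s u w F F' : emb s F -> L u \in verts s \/ s = [::] ->
  u != w -> ~~ adj s (L u) (L w) ->
  (exists2 p, is_rotation (add_edge (gr s) (u, w)) p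
            & nfaces (add_edge (gr s) (u, w)) p = F') ->
  emb ((L u, L w) :: s) F'.
Proof.
move=> es us nuw nadj [p rp Fp]; have Eg := gr_cons s u w.
have [h1 h2 h3 h4 _] := es; have ge := gr_graph es.
split=> [a|a|| |].
- rewrite verts_cons => /or3P[/eqP->|/eqP->|/h1 //]; exact: codom_f.
- rewrite adj_cons (negPf (h2 a)) orbF orbb; apply: contra nuw => /andP[/eqP-> /eqP].
  by move/injL->.
- rewrite /= doubleS -h3 -addn2 -(@card_darts_add _ _ (u, w)) //.
    by apply: eq_card => d; rewrite !inE /is_dart Eg.
  by rewrite /dart_rev /= xpair_eqE negb_and eq_sym nuw.
- have cs : connect_sym (gr ((L u, L w) :: s)).
    by apply: sym_connect_sym => x y; apply: adj_sym.
  (* All vertices are connected through [u], which is old unless the list was empty. *)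
  have cu z : L z \in verts ((L u, L w) :: s) -> connect (gr ((L u, L w) :: s)) u z.
    rewrite verts_cons => /or3P[/eqP/injL->|/eqP/injL->|zs] //.
      by apply: connect1; rewrite Eg /add_edge /add_dart eqxx orbT.
    case: us => [us|s0]; last by rewrite s0 in zs.
    apply: connect_sub (h4 _ _ us zs) => x y xy; apply: connect1.
    by rewrite Eg /add_edge /add_dart xy.
  by move=> x y /cu ux /cu; apply: connect_trans; rewrite cs.
- by exists p; rewrite ?(eq_is_rotation _ Eg) // (eq_nfaces _ Eg).
Qed.

Lemma verts_dart s F u : emb s F -> L u \in verts s ->
  exists2 d, is_dart (gr s) d & d.1 = u.
Proof.
move=> es /vertsP[b ub]; have /codomP[w bw] := emb_verts es (proj2 (andP (adj_verts ub))).
by exists (u, w); rewrite // /is_dart /gr /= -bw.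
Qed.

Lemma emb_edge a b : a \in codom L -> b \in codom L -> a != b -> emb [:: (a, b)] 1.
Proof.
move=> /codomP[u ->] /codomP[w ->]; rewrite (inj_eq injL) => nuw.
apply: emb_extend emb_nil _ _ _ _; rewrite //; first by right.
have [||rp F1] := @nfaces_single _ (gr [::]) (u, w); last by exists 1%g.
  by [].
by rewrite /dart_rev /= xpair_eqE negb_and eq_sym nuw.
Qed.

Lemma emb_pendant s F a b : emb s F -> a \in verts s -> b \notin verts s ->
  b \in codom L -> emb ((a, b) :: s) F.
Proof.
move=> es as_ bs /codomP[w bw]; have /codomP[u au] := emb_verts es as_.
rewrite {}au {}bw in as_ bs *.
have nuw : u != w by apply: contraNneq bs => <-.
have nadj : ~~ adj s (L u) (L w) by apply: contra bs => /adj_verts/andP[].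
apply: (emb_extend es (or_introl as_) nuw nadj).
have [p rp Fp] := emb_rot es; have [a' ea' a'u] := verts_dart es as_.
have nd : dart_rev (u, w) != (u, w) by rewrite /dart_rev /= xpair_eqE negb_and eq_sym nuw.
have [|rp' Fp'] := add_pendant (gr_graph es) rp (d := (u, w)) nadj nd ea' a'u.
  by move=> x xw; apply: contra bs; rewrite /is_dart /gr xw => /adj_verts/andP[].
by eexists; [exact: rp' | rewrite Fp'].
Qed.

(** With a single face, both ends are on it and the new edge splits it. *)
Lemma emb_chord s a b : emb s 1 -> a \in verts s -> b \in verts s -> a != b ->
  ~~ adj s a b -> emb ((a, b) :: s) 2.
Proof.
move=> es as_ bs; have /codomP[u au] := emb_verts es as_; have /codomP[w bw] := emb_verts es bs.
rewrite {}au {}bw in as_ bs *; rewrite (inj_eq injL) => nuw nadj.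
apply: (emb_extend es (or_introl as_) nuw nadj).
have [p rp Fp] := emb_rot es; have ge := gr_graph es.
have [a' ea' a'u] := verts_dart es as_; have [b' eb' b'w] := verts_dart es bs.
have nd : dart_rev (u, w) != (u, w) by rewrite /dart_rev /= xpair_eqE negb_and eq_sym nuw.
eexists; first exact: (add_edge_rotation ge rp (d := (u, w)) nadj nd ea' a'u eb' b'w).
have := add_edge_nfaces ge rp (d := (u, w)) nadj nd ea' a'u eb' b'w.
by rewrite (nfaces1_porbit Fp) ?is_dart_rev // Fp addn0.
Qed.

Lemma emb_cherry s a b c : emb s 1 -> a \in verts s -> b \in verts s -> c \in verts s ->
  a != b -> a != c -> b != c -> ~~ adj s a b -> ~~ adj s a c ->
  emb [:: (a, c), (a, b) & s] 1.
Proof.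
(* Connectivity and edge count for the first edge come from [es2]; the rotation comes from
   [add_cherry], applied to the one-face rotation of [s]. *)
move=> es as_ bs cs nab nac nbc adab adac; have es2 := emb_chord es as_ bs nab adab.
have /codomP[u au] := emb_verts es as_; have /codomP[w bw] := emb_verts es bs.
have /codomP[z cz] := emb_verts es cs.
rewrite {}au {}bw {}cz in as_ bs cs nab nac nbc adab adac es2 *.
rewrite !(inj_eq injL) in nab nac nbc.
apply: (emb_extend es2 _ nac).
- by left; rewrite verts_cons eqxx.
- rewrite adj_cons (negPf adac) !(inj_eq injL) [z == w]eq_sym (negPf nbc) andbF.
  by rewrite [z == u]eq_sym (negPf nac).
have [p rp Fp] := emb_rot es; have ge := gr_graph es.
have [a' ea' a'u] := verts_dart es as_; have [b' eb' b'w] := verts_dart es bs.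
have [c' ec' c'z] := verts_dart es cs.
have ndd : (u, z) != (u, w) by rewrite xpair_eqE eqxx eq_sym.
have nd : dart_rev (u, w) != (u, w) by rewrite /dart_rev /= xpair_eqE negb_and eq_sym nab.
have nd' : dart_rev (u, z) != (u, z) by rewrite /dart_rev /= xpair_eqE negb_and eq_sym nac.
have [p' rp' Fp'] := add_cherry ge rp Fp (d := (u, w)) (d' := (u, z)) erefl ndd nd' nd
  adab adac ea' a'u eb' b'w ec' c'z.
have Eg := eq_add_edge (u, z) (gr_cons s u w).
by exists p'; rewrite ?(eq_is_rotation _ Eg) // (eq_nfaces _ Eg).
Qed.

(** Once every vertex occurs in the list, connectivity holds for the whole graph, and the size
    equation identifies [beta] as its Betti number. *)
Lemma emb_max_genus s beta (e : rel V) : emb s (1 + odd beta) -> e =2 gr s -> 0 < size s ->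
  (forall x, L x \in verts s) -> size s + 1 = #|V| + beta ->
  [/\ connectedb e, betti e = beta & max_genus e = beta./2].
Proof.
move=> [_ _ h3 h4 [p rp Fp]] E s0 vs sz.
have ne : nedges e = size s by rewrite (eq_nedges E) /nedges h3 -muln2 mulnK.
have be : betti e = beta by rewrite /betti ne sz addKn.
split=> //; first by apply/forallP => x; apply/forallP => y; rewrite (eq_connect E) h4.
rewrite -be; apply: (@max_genus_eq _ _ p).
- by rewrite ne.
- by rewrite (eq_is_rotation _ E).
- by rewrite (eq_nfaces _ E) be.
- by rewrite ne sz leq_addr.
Qed.

End Labelled.

(** * Spirals *)

(** The index counts edges: for positive [k] the path has vertices [1] to [k.+1], so a path on [m]
    vertices is [path_edges m.-1]. *)
Fixpoint path_edges k := if k is k'.+1 then (k, k.+1) :: path_edges k' else [::].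

Definition target m i := if i <= m - 1 then i else 2 * i - m + 1.

Definition arm_edges m i :=
  let s := m + 2 * i - 2 in [:: (s, s.+1); (s.+1, s.+2); (s.+2, target m i)].

Fixpoint spiral_edges m n :=
  if n is n'.+1 then arm_edges m n ++ spiral_edges m n' else (m, 1) :: path_edges m.-1.

Lemma size_path_edges k : size (path_edges k) = k.
Proof. by elim: k => //= k ->. Qed.

Lemma size_spiral_edges m n : 0 < m -> size (spiral_edges m n) = m + 3 * n.
Proof. by move=> m0; elim: n => [|n IH] /=; rewrite ?size_path_edges ?IH; lia. Qed.

Lemma mem_path_edges k a b : ((a, b) \in path_edges k) = (1 <= a <= k) && (b == a.+1).
Proof. by elim: k => [|k IH] /=; rewrite ?inE ?xpair_eqE ?IH ?in_nil; lia. Qed.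

Lemma verts_path_edges k a : a \in verts (path_edges k) = (0 < k) && (1 <= a <= k.+1).
Proof. by elim: k => [|k IH] /=; rewrite ?verts_cons ?IH //; lia. Qed.

(** Peels the last arm off the existential in [spiral_base], to match the recursion of
    [spiral_edges]. *)
Lemma exists_ord_recr (P : pred nat) n :
  [exists i : 'I_n.+1, P i] = [exists i : 'I_n, P i] || P n.
Proof.
apply/existsP/orP => [[i Pi]|[/existsP[i Pi]|Pn]].
- have [E|ni] := eqVneq (i : nat) n; first by right; rewrite -E.
  have hi : i < n by have := ltn_ord i; lia.
  by left; apply/existsP; exists (Ordinal hi).
- by exists (widen_ord (leqnSn n) i).
- by exists ord_max.
Qed.

Lemma spiral_baseE m n a b : 0 < m -> spiral_base m n a b = ((a, b) \in spiral_edges m n).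
Proof.
move=> m0; elim: n => [|n IH].
  rewrite /= inE mem_path_edges xpair_eqE /spiral_base.
  (* Without arms the only index is [0], which [0 < i] rules out. *)
  case: existsP => [[[[|i] //= hi]]|_]; lia.
rewrite /= !inE -IH !xpair_eqE /spiral_base.
pose P i := (0 < i) && (let s := m + 2 * i - 2 in
  [|| (a == s) && (b == s.+1), (a == s.+1) && (b == s.+2) | (a == s.+2) && (b == target m i)]).
rewrite -!/(P _) (exists_ord_recr P) {2}/P /=.
by case: (_ && (b == a.+1)); case: (_ && (b == 1)); rewrite /= ?orbT // orbC -!orbA.
Qed.

Lemma spiral_adjE m n a b : 0 < m -> spiral_adj m n a b = adj (spiral_edges m n) a b.
Proof. by move=> m0; rewrite /spiral_adj !spiral_baseE. Qed.

(** Each arm ends on a vertex of the spiral with one arm less. *)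
Lemma target_bounds m i : 2 < m -> 0 < i -> 0 < target m i <= m + 2 * i - 2.
Proof. by rewrite /target; case: ifP; lia. Qed.

Lemma verts_spiral_edges m n a : 2 < m ->
  a \in verts (spiral_edges m n) = (1 <= a <= m + 2 * n).
Proof.
move=> m3; elim: n => [|n IH]; first by rewrite /= verts_cons verts_path_edges; lia.
by rewrite /= !verts_cons IH; have := @target_bounds m n.+1 m3 isT; lia.
Qed.

Lemma adj_fresh s a b : a \notin verts s -> adj s a b = false.
Proof. by move=> h; apply: contraNF h => /adj_verts/andP[]. Qed.

(** * Embeddings of spirals over any vertex type carrying the labels *)

Section SpiralEmbedding.
Variables (V : finType) (L : V -> nat).
Hypothesis injL : injective L.

Lemma emb_path k : 0 < k -> (forall l, 1 <= l <= k.+1 -> l \in codom L) ->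
  emb L (path_edges k) 1.
Proof.
case: k => // k _; elim: k => [|k IH] H; first by apply: emb_edge => //; apply: H.
apply: (@emb_pendant _ _ injL (path_edges k.+1)); rewrite ?verts_path_edges //; try lia.
- by apply: IH => l hl; apply: H; lia.
- by apply: H; lia.
Qed.

Variable m : nat.
Hypothesis m3 : 2 < m.

Lemma emb_cycle : (forall l, 1 <= l <= m -> l \in codom L) ->
  emb L (spiral_edges m 0) 2.
Proof.
move=> H; apply: emb_chord => //; rewrite ?verts_path_edges; try lia.
  by apply: emb_path; [lia | move=> l hl; apply: H; lia].
by rewrite /adj !mem_path_edges; lia.
Qed.

(** Without the edges from [m] to [1] and to [m.+1] the graph is the path [m.+1], [m.+2], [1], ...,
    [m]; these two edges share the end [m] and are added as a cherry. *)
Lemma emb_theta : (forall l, 1 <= l <= m + 2 -> l \in codom L) ->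
  emb L (spiral_edges m 1) 1.
Proof.
move=> H.
have e0 : emb L (path_edges m.-1) 1 by apply: emb_path; [lia | move=> l hl; apply: H; lia].
have e1 : emb L ((1, m.+2) :: path_edges m.-1) 1.
  by apply: emb_pendant; rewrite ?verts_path_edges //; try lia; apply: H; lia.
have e2 : emb L [:: (m.+2, m.+1), (1, m.+2) & path_edges m.-1] 1.
  by apply: emb_pendant; rewrite ?verts_cons ?verts_path_edges //; try lia; apply: H; lia.
have e3 := emb_flip e2.
have : emb L [:: (m, 1), (m, m.+1), (m.+1, m.+2), (1, m.+2) & path_edges m.-1] 1.
  apply: emb_cherry => //; rewrite ?verts_cons ?verts_path_edges ?adj_cons; try lia;
    by rewrite /adj !mem_path_edges; lia.
set s := path_edges _ => e4.
have e5 : emb L [:: (1, m.+2), (m, 1), (m, m.+1), (m.+1, m.+2) & s] 1.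
  by apply: emb_perm e4; apply/seq.permP => q /=; lia.
have -> : spiral_edges m 1 = [:: (m, m.+1); (m.+1, m.+2); (m.+2, 1)] ++ (m, 1) :: s.
  rewrite /= /arm_edges /target /= -/s.
  have -> : m + 2 * 1 - 2 = m by lia.
  by have -> : 0 < m - 1 by lia.
by apply: emb_perm (emb_flip e5); apply/seq.permP => q /=; lia.
Qed.

(** The first two edges of the arm are pendant, and the third is a chord. *)
Lemma emb_spiralS k : (forall l, 1 <= l <= m + 2 * k.+1 -> l \in codom L) ->
  emb L (spiral_edges m k) 1 -> emb L (spiral_edges m k.+1) 2.
Proof.
move=> H e0 /=; have t := @target_bounds m k.+1 m3 isT.
move: t H; rewrite /arm_edges; have -> : m + 2 * k.+1 - 2 = m + 2 * k by lia.
set x := m + 2 * k; set s := spiral_edges m k => t H.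
have vs l : l \in verts s = (1 <= l <= x) by apply: verts_spiral_edges.
have e1 : emb L ((x, x.+1) :: s) 1.
  by apply: emb_pendant; rewrite ?vs //; try lia; apply: H; lia.
have e2 : emb L [:: (x.+1, x.+2), (x, x.+1) & s] 1.
  by apply: emb_pendant; rewrite ?verts_cons ?vs //; try lia; apply: H; lia.
have : emb L [:: (x.+2, target m k.+1), (x.+1, x.+2), (x, x.+1) & s] 2.
  apply: emb_chord; rewrite ?verts_cons ?vs ?adj_cons //; try lia.
  by rewrite adj_fresh ?vs; lia.
by apply: emb_perm; apply/seq.permP => q /=; lia.
Qed.

(** With [x = m + 2 * k], the pendant paths [x], [x.+1], [x.+2] and [t2], [x.+4], [x.+3] are grown
    first. The two edges left run from [x.+2] to [t1] and to [x.+3]: a cherry. *)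
Lemma emb_spiralSS k : (forall l, 1 <= l <= m + 2 * k.+2 -> l \in codom L) ->
  emb L (spiral_edges m k) 1 -> emb L (spiral_edges m k.+2) 1.
Proof.
move=> H e0 /=; have t := @target_bounds m k.+1 m3 isT.
(* The second arm, too, ends on the old spiral and not on the interior of the first arm. *)
have t' : 0 < target m k.+2 <= m + 2 * k.+2 - 2 /\ target m k.+2 \notin [:: m + 2 * k + 1; m + 2 * k + 2].
  by rewrite /target !inE; case: ifP; lia.
move: t t' H; rewrite /arm_edges; have -> : m + 2 * k.+1 - 2 = m + 2 * k by lia.
have -> : m + 2 * k.+2 - 2 = m + 2 * k + 2 by lia.
have -> : m + 2 * k.+2 = m + 2 * k + 4 by lia.
rewrite !inE; set x := m + 2 * k; set s := spiral_edges m k; rewrite !addnS addn0 => t t' H.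
have vs l : l \in verts s = (1 <= l <= x) by apply: verts_spiral_edges.
set t1 := target m k.+1 in t *; set t2 := target m k.+2 in t' *.
have e1 : emb L ((x, x.+1) :: s) 1.
  by apply: emb_pendant; rewrite ?vs //; try lia; apply: H; lia.
have e2 : emb L [:: (x.+1, x.+2), (x, x.+1) & s] 1.
  by apply: emb_pendant; rewrite ?verts_cons ?vs //; try lia; apply: H; lia.
have e3 : emb L [:: (t2, x.+4), (x.+1, x.+2), (x, x.+1) & s] 1.
  by apply: emb_pendant; rewrite ?verts_cons ?vs //; try lia; apply: H; lia.
have e4 : emb L [:: (x.+4, x.+3), (x.+4, t2), (x.+1, x.+2), (x, x.+1) & s] 1.
  apply: emb_pendant; rewrite ?verts_cons ?vs //; try lia; last by apply: H; lia.
  exact: emb_flip.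
have : emb L [:: (x.+2, x.+3), (x.+2, t1), (x.+3, x.+4), (x.+4, t2), (x.+1, x.+2),
    (x, x.+1) & s] 1.
  apply: emb_cherry; rewrite ?verts_cons ?vs ?adj_cons //; try lia; first exact: emb_flip.
    by rewrite adj_fresh ?vs; lia.
  by rewrite adj_fresh ?vs; lia.
by apply: emb_perm; apply/seq.permP => q /=; lia.
Qed.

(** Odd [n] is reached from [emb_theta] two arms at a time, positive even [n] by one more arm, and
    [n = 0] is the cycle. As [V] may carry further labels, this also serves for the smaller spiral
    inside the vertex-deleted one. *)
Lemma emb_spiral n : (forall l, 1 <= l <= m + 2 * n -> l \in codom L) ->
  emb L (spiral_edges m n) (1 + ~~ odd n).
Proof.
have odd_case k : (forall l, 1 <= l <= m + 2 * k.*2.+1 -> l \in codom L) ->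
    emb L (spiral_edges m k.*2.+1) 1.
  elim: k => [|k IH] H; first by apply: emb_theta => l hl; apply: H; lia.
  rewrite doubleS; apply: emb_spiralSS => [l hl|]; first by apply: H; lia.
  by apply: IH => l hl; apply: H; lia.
have odd_case' j : odd j -> (forall l, 1 <= l <= m + 2 * j -> l \in codom L) ->
    emb L (spiral_edges m j) 1.
  by move=> oj; have -> : j = j./2.*2.+1; [lia | exact: odd_case].
case: n => [|n] H; first by apply: emb_cycle => l hl; apply: H; lia.
rewrite oddS negbK; have [on|en] := boolP (odd n); last exact: odd_case'.
by apply: emb_spiralS => //; apply: odd_case' => // l hl; apply: H; lia.
Qed.

Lemma emb_spiral_del n : 0 < n ->
  (forall l, 1 <= l <= m + 2 * n -> l != m + 2 * n - 2 -> l \in codom L) ->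
  exists s, [/\ emb L s (1 + odd n.-1),
    forall a b, a != m + 2 * n - 2 -> b != m + 2 * n - 2 ->
      adj (spiral_edges m n) a b = adj s a b,
    size s = m + 3 * n - 3 &
    forall l, 1 <= l <= m + 2 * n -> l != m + 2 * n - 2 -> l \in verts s].
Proof.
move=> n0; case: n n0 => // -[|k] _ cL.
  (* For one arm the deleted vertex is [m], and the path [m.+1], [m.+2], [1], ..., [m.-1]
     remains. *)
  exists [:: (m.+2, m.+1), (1, m.+2) & path_edges m.-2].
  have ep : emb L (path_edges m.-2) 1.
    by apply: emb_path => [|l hl]; [lia | apply: cL; lia].
  split.
  - apply: emb_pendant; rewrite ?verts_cons ?verts_path_edges //; try lia; last by apply: cL; lia.
    by apply: emb_pendant; rewrite ?verts_cons ?verts_path_edges //; try lia; apply: cL; lia.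
  - move=> a b; rewrite /= /arm_edges /target.
    have -> : m + 2 * 1 - 2 = m by lia.
    have -> : 0 < m - 1 by lia.
    have -> : path_edges m.-1 = (m.-1, m) :: path_edges m.-2.
      by case: (m) m3 => [|[|j]] //=.
    move=> na nb; rewrite [RHS]adj_flip !adj_cons.
    rewrite (negPf na) (negPf nb) !andbF /=.
    by rewrite [(a == m.+2) && _]andbC [(b == m.+2) && _]andbC; congr [|| _, _ | _]; rewrite orbCA.
  - by rewrite /= size_path_edges; lia.
  - by move=> l; rewrite !verts_cons verts_path_edges; lia.
(* Here [n] is [k.+2] and the deleted vertex is [x.+2], where the last two arms meet. By [ht] the
   last arm ends on the spiral [s], so its remainder is a pendant path. *)
pose x := m + 2 * k; pose s := spiral_edges m k; pose t := target m k.+2.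
have ht : 0 < t <= x by rewrite /t /x /target; case: ifP; lia.
have vs l : l \in verts s = (1 <= l <= x) by apply: verts_spiral_edges.
have Ex : m + 2 * k.+2 = x.+4 by rewrite /x; lia.
have es : emb L s (1 + ~~ odd k) by apply: emb_spiral => // l hl; apply: cL; rewrite /x in Ex *; lia.
exists [:: (x.+4, x.+3), (t, x.+4), (x, x.+1) & s]; rewrite Ex in cL *; split.
- have e1 : emb L ((x, x.+1) :: s) (1 + ~~ odd k).
    by apply: emb_pendant; rewrite ?vs //; try lia; apply: cL; lia.
  have e2 : emb L [:: (t, x.+4), (x, x.+1) & s] (1 + ~~ odd k).
    by apply: emb_pendant; rewrite ?verts_cons ?vs //; try lia; apply: cL; lia.
  by apply: emb_pendant; rewrite ?verts_cons ?vs //; try lia; apply: cL; lia.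
- move=> a b; rewrite /= /arm_edges -/s -/t.
  have -> : m + 2 * k.+1 - 2 = x by rewrite /x; lia.
  have -> : m + 2 * k.+2 - 2 = x.+2 by lia.
  (* The three edges at [x.+2] drop out; what follows only reorders the others. *)
  move=> na nb; rewrite !adj_cons (negPf na) (negPf nb) !andbF /=.
  rewrite [(a == x.+4) && (b == t)]andbC [(b == x.+4) && (a == t)]andbC.
  rewrite [(a == x.+4) && (b == x.+3)]andbC [(b == x.+4) && (a == x.+3)]andbC.
  by rewrite orbCA; congr [|| _, _ | _]; rewrite orbCA.
- by rewrite /= /s size_spiral_edges; lia.
- by move=> l; rewrite !verts_cons vs; lia.
Qed.

End SpiralEmbedding.

(** * Maximum genus of the spiral and of the vertex-deleted spiral *)

Lemma betti_max_genus_spiral m n : 2 < m ->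
  betti (spiral m n) = n.+1 /\ max_genus (spiral m n) = n.+1./2.
Proof.
move=> m3; pose L (x : 'I_(m + 2 * n)) := x.+1.
have injL : injective L by move=> x y [/val_inj].
have cL l : 1 <= l <= m + 2 * n -> l \in codom L.
  move=> hl; have hl' : l.-1 < m + 2 * n by lia.
  by apply/codomP; exists (Ordinal hl'); rewrite /L /=; lia.
have [|x y||x||_ -> ->] // := @emb_max_genus _ L (spiral_edges m n) n.+1 (spiral m n).
- exact: emb_spiral.
- by rewrite /spiral spiral_adjE //; lia.
- by rewrite size_spiral_edges; lia.
- by rewrite verts_spiral_edges // /L; have := ltn_ord x; lia.
- by rewrite size_spiral_edges ?card_ord; lia.
Qed.

(** The deleted vertex takes three edges with it, so the Betti number falls from [n.+1] to
    [n.-1]. *)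
Lemma max_genus_spiral_del m n (v : 'I_(m + 2 * n)) : 2 < m -> 0 < n ->
  val v = m + 2 * n - 3 ->
  connectedb (del_vertex (spiral m n) v) /\
  max_genus (del_vertex (spiral m n) v) = n.-1./2.
Proof.
move=> m3 n0 hv; pose L (x : {x | x != v}) := (nat_of_ord (val x)).+1.
have injL : injective L by move=> x y [/val_inj/val_inj].
have cL l : 1 <= l <= m + 2 * n -> l != m + 2 * n - 2 -> l \in codom L.
  move=> hl lv; have hl' : l.-1 < m + 2 * n by lia.
  have nv : Ordinal hl' != v by rewrite -val_eqE /= hv; lia.
  by apply/codomP; exists (Sub (Ordinal hl') nv); rewrite /L SubK /=; lia.
have Lb x : (1 <= L x <= m + 2 * n) && (L x != m + 2 * n - 2).
  by case: x => x nx; rewrite /L /=; move: nx; rewrite -val_eqE /= hv; have := ltn_ord x; lia.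
have cV : #|{: {x | x != v}}| = (m + 2 * n).-1.
  by rewrite card_sig -[in RHS](card_ord (m + 2 * n)) -(cardC1 v).
have [s [es E sz vs]] := emb_spiral_del injL m3 n0 cL.
have [|x y||x||-> _ ->] // := @emb_max_genus _ L s n.-1 (del_vertex (spiral m n) v).
  - have /andP[_ nx] := Lb x; have /andP[_ ny] := Lb y.
    by rewrite /del_vertex /spiral spiral_adjE; [apply: E | lia].
  - by rewrite sz; lia.
  - by apply: vs; case/andP: (Lb x).
  - by rewrite sz cV; lia.
Qed.

(* v : 'I_(m+2n) with val v = m+2n-3 is the vertex v_(m+2n-2) *)
Theorem theorem3p2 (m n : nat) (hm : 3 <= m) (hn : 1 <= n)
    (v : 'I_(m + 2 * n)) (hv : val v = m + 2 * n - 3) :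
  upper_embeddable (spiral m n) /\
  max_genus (spiral m n) = (n + 1)./2 /\
  connectedb (del_vertex (spiral m n) v) /\
  max_genus (del_vertex (spiral m n) v) = max_genus (spiral m n) - 1.
Proof.
have [be mg] := betti_max_genus_spiral n hm.
have [co dg] := max_genus_spiral_del hm hn hv.
(* As [n] is positive, [n.+1] is [n.-1] plus two, so the halves differ by exactly one. *)
by rewrite /upper_embeddable be dg mg addn1; do !split => //; lia.
Qed.
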